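(* Let $\mathcal N,\mathcal M\ge 0$ be integers and let $G:[-1,1]\times\mathbb R\to\mathbb R$ be a product $$G(x,y)=\prod_{i=1}^{\mathcal N}f_i(x)\prod_{j=1}^{\mathcal M}g_j(y),\qquad f_i\in\mathcal F_{\mathrm{all}},\ g_j\in\mathcal G_{\mathrm{all}},$$ where $\mathcal N$ and $\mathcal M$ are regarded as constants. Let $h_j(z)$, $z=e^{\mathrm i y}$, denote the Laurent polynomial representation of $g_j(y)$, and let the degree of $G$ be the tuple $(n_p,m_p)$ with $$n_p=\sum_{i=1}^{\mathcal N}\deg(f_i),\qquad m_p=\sum_{j=1}^{\mathcal M}\deg(h_j).$$ Then, for any $\delta\in(0,\delta_0]$ (with $\delta_0\in(0,1/2]$ an absolute constant), $G$ can be $\delta$-approximated by a polynomial of degree $$\Bigl(O\bigl(\sqrt{n_p\ln(1/\delta)}\bigr),\ O\bigl(\sqrt{m_p\ln(1/\delta)}\bigr)\Bigr).$$ That is, there are a polynomial $P(x)$ of degree $O(\sqrt{n_p\ln(1/\delta)})$ and a Laurent polynomial $L(z)$ of degree $O(\sqrt{m_p\ln(1/\delta)})$ such that $$\sup_{x\in[-1,1],\,y\in\mathbb R}\bigl|G(x,y)-P(x)\,L(e^{\mathrm i y})\bigr|\le\delta .$$ The constants implied by $O(\cdot)$ depend only on $\mathcal N,\mathcal M$ (not on the functions $f_i,g_j$, on their parameters $n,\beta,\gamma,\lambda$, or on $\delta$).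
   Context: Function classes. On $x\in[-1,1]$: $\mathcal F_{\mathrm{mon}}=\{x^n: n\in\mathbb N\}$, $\mathcal F_{\mathrm{exp}}=\{e^{-\beta(1+x)}:\beta>0\}$, $\mathcal F_{\mathrm{gauss}}=\{e^{-(\gamma x)^2}:\gamma\ge0\}$, $\mathcal F_{\mathrm{erf}}=\{\operatorname{erf}(\lambda x):\lambda>0\}$, where $\operatorname{erf}(\lambda x)=\frac{2\lambda}{\sqrt\pi}\int_0^x e^{-(\lambda u)^2}\,du$. Set $\mathcal F_{\mathrm{all}}=\mathcal F_{\mathrm{mon}}\cup\mathcal F_{\mathrm{exp}}\cup\mathcal F_{\mathrm{gauss}}\cup\mathcal F_{\mathrm{erf}}$. For each class $\mathcal F_i$, let $\mathcal F_i^{(\cos)}$ and $\mathcal F_i^{(\sin)}$ be the sets of functions of $y\in\mathbb R$ obtained by substituting $x=\cos y$ and $x=\sin y$, respectively, in the elements of $\mathcal F_i$ (e.g. $\mathcal F_{\mathrm{mon}}^{(\cos)}=\{\cos^n y:n\in\mathbb N\}$). Set $\mathcal G_{\mathrm{all}}=\bigcup_{i\in\{\mathrm{mon},\mathrm{exp},\mathrm{gauss},\mathrm{erf}\}}\bigl(\mathcal F_i^{(\cos)}\cup\mathcal F_i^{(\sin)}\bigr)$. Laurent polynomials. A Laurent polynomial of degree $l$ is $\sum_{k=-l}^{l}c_kz^k$ (with complex coefficients, $c_{\pm l}\ne0$), evaluated at $z=e^{\mathrm i y}$. The Laurent polynomial representation $h_j(z)$ of $g_j(y)$ is $g_j$ rewritten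 in the variable $z=e^{\mathrm i y}$, so $g_j(y)=h_j(e^{\mathrm i y})$ (for non-monomial classes, via its series truncated at the truncation degree below). Degrees of the functions. $\deg$ denotes the degree for monomials and the (Maclaurin) truncation degree at accuracy $\delta$ for the other functions: $\deg(x^n)=n$; $\deg(e^{-\beta(1+x)})=t_\beta$, of order $\beta+\ln(1/\delta)$; $\deg(e^{-(\gamma x)^2})=t_\gamma$, of order $\gamma^2+\ln(1/\delta)$; $\deg(\operatorname{erf}(\lambda x))=t_\lambda$, of order $\lambda^2+\ln(1/\delta)$. The $h_j$ corresponding to the cosine or sine version of a function has the same degree as that function. Because conclusions are up to $O(\cdot)$, one may take $t_\beta=\beta+\ln(1/\delta)$, $t_\gamma=\gamma^2+\ln(1/\delta)$, $t_\lambda=\lambda^2+\ln(1/\delta)$. For a function that is a product of a degree-$d_1$ polynomial in $x$ and a degree-$d_2$ Laurent polynomial in $z$, its degree is the tuple $(d_1,d_2)$. ''Degree $O(\cdot)$'' means degree at most the indicated quantity times a constant. ''$\delta$-approximated'' means uniform error at most $\delta$ over $(x,y)\in[-1,1]\times\mathbb R$. Conventions: an empty product is $1$ and an empty sum is $0$. *)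

(* Defs.v *)
From HB Require Import structures.
From mathcomp Require Import all_boot all_order all_algebra.
From mathcomp Require Import all_classical all_reals all_analysis.
From mathcomp Require Import complex.

Set Implicit Arguments.
Unset Strict Implicit.
Unset Printing Implicit Defensive.

Import Order.TTheory GRing.Theory Num.Theory.
Import numFieldNormedType.Exports.

Local Open Scope classical_set_scope.
Local Open Scope ring_scope.
Local Open Scope complex_scope.

Section FunctionClasses.
Context {R : realType}.
Implicit Types (f g : R -> R) (delta d : R).

(* Lebesgue integrals in the library are over sets, hence unoriented. *)
Definition oriented_integral (a b : R) (f : R -> R) : R :=
  if a <= b then Rintegral lebesgue_measure `[a, b] f
  else - Rintegral lebesgue_measure `[b, a] f.

Definition monomial_fun (n : nat) (x : R) : R := x ^+ n.
Definition exp_fun (beta x : R) : R := expR (- beta * (1 + x)).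
Definition gaussian_fun (gamma x : R) : R := expR (- (gamma * x) ^+ 2).
Definition erf_fun (lambda x : R) : R :=
  2 * lambda / Num.sqrt pi *
    oriented_integral 0 x (fun u => expR (- (lambda * u) ^+ 2)).

(* A function on [-1, 1] is a total function R -> R of which only the values
   on [-1, 1] matter. *)
Definition eq_on_unit f g : Prop := {in `[(-1 : R), 1], f =1 g}.

Definition F_mon : set (R -> R) :=
  [set f | exists n : nat, eq_on_unit f (monomial_fun n)].
Definition F_exp : set (R -> R) :=
  [set f | exists2 beta : R, 0 < beta & eq_on_unit f (exp_fun beta)].
Definition F_gauss : set (R -> R) :=
  [set f | exists2 gamma : R, 0 <= gamma & eq_on_unit f (gaussian_fun gamma)].
Definition F_erf : set (R -> R) :=
  [set f | exists2 lambda : R, 0 < lambda & eq_on_unit f (erf_fun lambda)].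

Definition F_all : set (R -> R) := F_mon `|` F_exp `|` F_gauss `|` F_erf.

Definition cos_class (F : set (R -> R)) : set (R -> R) :=
  [set f \o cos | f in F].
Definition sin_class (F : set (R -> R)) : set (R -> R) :=
  [set f \o sin | f in F].

Definition G_all : set (R -> R) :=
  \bigcup_(F in [set F_mon; F_exp; F_gauss; F_erf])
    (cos_class F `|` sin_class F).

(* The exact degree of a monomial, and the nominal (real-valued) Maclaurin
   truncation degree at accuracy delta of the other functions.  This is a
   relation because the classes overlap: the constant 1 is x^0, of degree 0,
   and also exp(-(0 x)^2), of truncation degree ln(1/delta). *)
Definition fun_degree delta f d : Prop :=
  [\/ exists2 n : nat, eq_on_unit f (monomial_fun n) & d = n%:R,
      exists beta : R, [/\ 0 < beta, eq_on_unit f (exp_fun beta)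
                         & d = beta + ln (1 / delta)],
      exists gamma : R, [/\ 0 <= gamma, eq_on_unit f (gaussian_fun gamma)
                          & d = gamma ^+ 2 + ln (1 / delta)]
    | exists lambda : R, [/\ 0 < lambda, eq_on_unit f (erf_fun lambda)
                           & d = lambda ^+ 2 + ln (1 / delta)]].

(* The degree of the Laurent polynomial h with g(y) = h(e^(iy)), h being
   obtained from f(cos y) or f(sin y) by substituting (z + 1/z)/2 or
   (z - 1/z)/(2i) in f, truncated at the degree of f unless f is a monomial:
   it is the degree of f. *)
Definition laurent_rep_degree delta g d : Prop :=
  exists2 f, fun_degree delta f d & g = f \o cos \/ g = f \o sin.

End FunctionClasses.

Record laurent (R : realType) := Laurent {
  laurent_degree : nat;
  laurent_coef : int -> R[i];
  laurent_coef_top : laurent_coef laurent_degree%:Z != 0;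
  laurent_coef_bot : laurent_coef (- laurent_degree%:Z) != 0
}.

(* The index k runs over -l, ..., l, shifted by l to be a natural number. *)
Definition laurent_eval (R : realType) (L : laurent R) (z : R[i]) : R[i] :=
  let l := laurent_degree L in
  \sum_(k < (2 * l).+1)
    laurent_coef L (k%:Z - l%:Z) * z ^ (k%:Z - l%:Z).

Definition expi (R : realType) (y : R) : R[i] := cos y +i* sin y.

(* The degree of P, with the convention that 0 has degree 0. *)
Definition poly_degree (R : realType) (P : {poly R}) : nat := (size P).-1.

(* Main.v *)
Require Import Defs.
From mathcomp Require Import all_boot all_order all_algebra.
From mathcomp Require Import all_classical all_reals all_analysis.
From mathcomp Require Import complex zify ring lra.

Import Order.TTheory GRing.Theory Num.Theory.
Import numFieldNormedType.Exports.

Local Open Scope classical_set_scope.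
Local Open Scope ring_scope.
Local Open Scope complex_scope.

(* Each factor is a mixture of monomials in x or in 2 x^2 - 1.  Writing
   x^n = E T_|S_n|(x) for a simple random walk S_n, Chernoff's bound shows that
   the Chebyshev modes beyond O(sqrt (d ln (1/delta))) carry total weight at
   most a power of delta.  For exp(-beta (1 + x)) the number of steps is
   Poisson, and exp(-(gamma x)^2) is exp(-beta (1 + y)) at beta = gamma^2 / 2,
   y = 2 x^2 - 1.  For erf, integrating T_j(2 u^2 - 1) gains a factor 1 / j,
   which absorbs the prefactor lambda.  Products of bounded factors are then
   approximated factor by factor. *)

Lemma ind2 (P : nat -> Prop) :
  P 0%N -> P 1%N -> (forall n, P n -> P n.+1 -> P n.+2) -> forall n, P n.
Proof.
move=> P0 P1 PS n; suff: P n /\ P n.+1 by case.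
by elim: n => [//|n [Pn Pn1]]; split => //; exact: PS.
Qed.

(** * Chebyshev polynomials and weighted Chebyshev expansions *)

Section Chebyshev.
Context {R : realType}.
Implicit Types (p q : {poly R}) (x u B : R) (n D : nat).

Fixpoint chebT n : {poly R} :=
  if n is n1.+1 then
    if n1 is n2.+1 then 'X *+ 2 * chebT n1 - chebT n2 else 'X
  else 1.

Fixpoint chebU n : {poly R} :=
  if n is n1.+1 then
    if n1 is n2.+1 then 'X *+ 2 * chebU n1 - chebU n2 else 'X *+ 2
  else 1.

Lemma chebTSS n : chebT n.+2 = 'X *+ 2 * chebT n.+1 - chebT n.
Proof. by []. Qed.

Lemma chebUSS n : chebU n.+2 = 'X *+ 2 * chebU n.+1 - chebU n.
Proof. by []. Qed.

(** Serves twice: to differentiate [T_n], and to integrate it in [chebT_prim]. *)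
Lemma chebT_chebU n : chebT n.+2 *+ 2 = chebU n.+2 - chebU n.
Proof.
elim/ind2: n => [||n IH0 IH1].
- by rewrite !chebTSS !chebUSS /=; ring.
- by rewrite !chebTSS !chebUSS /=; ring.
rewrite (chebTSS n.+2) (chebUSS n.+2) mulrnBl IH0 -mulrnAr IH1 (chebUSS n); ring.
Qed.

Lemma deriv_chebT n : (chebT n.+1)^`() = n.+1%:R *: chebU n.
Proof.
elim/ind2: n => [||n IH0 IH1]; first by rewrite /= derivX scale1r.
  rewrite /= derivB derivM derivMn derivX -[1]/(1%:P) derivC scaler_nat; ring.
have dX : ('X *+ 2 : {poly R})^`() = 2 by rewrite derivMn derivX.
rewrite chebTSS derivB derivM dX IH0 IH1.
have := chebT_chebU n; rewrite (chebUSS n) !scaler_nat => E.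
rewrite -[2 * _]/(2%:R * _) mulr_natl E; ring.
Qed.

(** The inner polynomial is [T_2], and composing Chebyshev polynomials multiplies their indices. *)
Lemma chebT_comp n : chebT n \Po ('X^2 *+ 2 - 1) = chebT n.*2.
Proof.
elim/ind2: n => [||n IH0 IH1]; first by rewrite comp_polyC.
  by rewrite comp_polyX /=; ring.
rewrite chebTSS comp_polyB comp_polyM mulr2n comp_polyD comp_polyX IH0 IH1.
by rewrite !doubleS (chebTSS n.*2.+2) (chebTSS n.*2.+1) (chebTSS n.*2); ring.
Qed.

Lemma size_chebT n : (size (chebT n) <= n.+1)%N.
Proof.
elim/ind2: n => [||n IH0 IH1]; first by rewrite size_poly1.
  by rewrite size_polyX.
rewrite chebTSS; apply: (leq_trans (size_polyD _ _)); rewrite size_polyN geq_max.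
rewrite (leq_trans IH0) ?andbT; last by rewrite ltnW.
rewrite mulrnAl -scaler_nat (leq_trans (size_scale_leq _ _))//.
by rewrite (leq_trans (size_polyMleq _ _))// size_polyX.
Qed.

Lemma horner_chebT_cos n (a : R) : (chebT n).[cos a] = cos (a *+ n).
Proof.
elim/ind2: n => [||n IH0 IH1]; first by rewrite hornerC mulr0n cos0.
  by rewrite hornerX mulr1n.
rewrite chebTSS hornerD hornerN hornerM hornerMn hornerX IH0 IH1 !mulrS.
rewrite !cosD !sinD.
have E : sin a * sin a = 1 - cos a * cos a by rewrite -!expr2 sin2cos2.
ring: E.
Qed.

Lemma chebT_le1 n x : -1 <= x <= 1 -> `|(chebT n).[x]| <= 1.
Proof.
move=> x1; rewrite -(acosK (x := x)) ?horner_chebT_cos ?cos_max//.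
Qed.

Lemma unit_comp x : -1 <= x <= 1 -> -1 <= x ^+ 2 *+ 2 - 1 <= 1.
Proof. by move=> /andP[x0 x1]; nra. Qed.

(* [p] has an expansion [sum_j a_j T_j] with [sum_j |a_j| (u^j + u^-j) <= B]. *)
Inductive cheb_exp u : {poly R} -> R -> Prop :=
| cheb_expT n : cheb_exp u (chebT n) (u ^+ n + u ^- n)
| cheb_expD p q B B' :
    cheb_exp u p B -> cheb_exp u q B' -> cheb_exp u (p + q) (B + B')
| cheb_expZ (a : R) p B :
    cheb_exp u p B -> cheb_exp u (a *: p) (`|a| * B).

(** One step of the random walk: [x T_n = (T_(n+1) + T_(n-1)) / 2], and [u^n + u^-n] is an
    eigenfunction of this averaging with eigenvalue [(u + u^-1) / 2]. *)
Lemma cheb_expMX u p B : 0 < u ->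
  cheb_exp u p B -> cheb_exp u ('X * p) ((u + u^-1) / 2 * B).
Proof.
move=> u0; elim=> [[|n]|{}p q {}B B' _ IHp _ IHq|a {}p {}B _ IH].
- rewrite mulr1 (_ : _ / 2 * _ = u ^+ 1 + u ^- 1); first exact: (cheb_expT u 1).
  rewrite expr0 expr1 invr1; field; exact: lt0r_neq0.
- have -> : 'X * chebT n.+1 = 2^-1 *: (chebT n.+2 + chebT n).
    rewrite chebTSS subrK mulrnAl -[X in _ *: X]scaler_nat scalerA mulVf ?scale1r//.
  have -> : (u + u^-1) / 2 * (u ^+ n.+1 + u ^- n.+1) =
      `|2^-1| * ((u ^+ n.+2 + u ^- n.+2) + (u ^+ n + u ^- n)).
    rewrite ger0_norm ?invr_ge0// !exprS.
    by field; rewrite expf_neq0 lt0r_neq0.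
  by apply: cheb_expZ; apply: cheb_expD; apply: cheb_expT.
- by rewrite !mulrDr; apply: cheb_expD.
- by rewrite -scalerAr mulrCA; apply: cheb_expZ.
Qed.

(** Markov's inequality on the modes: a dropped [T_n] has [n > D] and norm at most 1, while its
    weight in [B] is at least [u^D]. *)
Lemma cheb_exp_trunc u D p B : 1 <= u -> cheb_exp u p B ->
  exists2 q : {poly R}, (size q <= D.+1)%N &
    forall x, -1 <= x <= 1 -> `|p.[x] - q.[x]| <= B * u ^- D.
Proof.
move=> u1; have u0 : 0 < u by apply: lt_le_trans u1.
have u0' := ltW u0.
elim=> [n|{}p q {}B B' _ [p' sp Hp] _ [q' sq Hq]|a {}p {}B _ [p' sp Hp]].
- have [nD|Dn] := leqP n D.
    exists (chebT n); first by rewrite (leq_trans (size_chebT n)).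
    by move=> x _; rewrite subrr normr0 mulr_ge0 ?addr_ge0 ?invr_ge0 ?exprn_ge0.
  exists 0 => [|x x1]; first by rewrite size_poly0.
  rewrite horner0 subr0 (le_trans (chebT_le1 _ _ x1))// ler_pdivlMr ?exprn_gt0//.
  by rewrite mul1r ler_wpDr ?invr_ge0 ?exprn_ge0 ?ler_weXn2l// ltnW.
- exists (p' + q') => [|x x1].
    by rewrite (leq_trans (size_polyD _ _))// geq_max sp.
  rewrite !hornerD mulrDl opprD addrACA (le_trans (ler_normD _ _))//.
  by rewrite lerD ?Hp ?Hq.
- exists (a *: p') => [|x x1]; first by rewrite (leq_trans (size_scale_leq _ _)).
  by rewrite !hornerZ -mulrBr normrM -mulrA ler_wpM2l ?Hp.
Qed.

(** Since [2 T_k = U_k - U_(k-2)] and [T_k' = k U_(k-1)], this is an antiderivative of [T_(2n)],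
    that is, of [T_n(2 u^2 - 1)]. *)
Definition chebT_prim n : {poly R} :=
  if n is m.+1 then
    2^-1 *: (n.*2.+1%:R^-1 *: chebT n.*2.+1 - m.*2.+1%:R^-1 *: chebT m.*2.+1)
  else 'X.

Lemma deriv_chebT_prim n : (chebT_prim n)^`() = chebT n \Po ('X^2 *+ 2 - 1).
Proof.
rewrite chebT_comp; case: n => [|n]; first by rewrite derivX.
rewrite /chebT_prim derivZ derivB !derivZ !deriv_chebT !scalerA.
rewrite !mulVf ?pnatr_eq0// !scale1r doubleS -chebT_chebU.
rewrite -[X in _ *: X]scaler_nat scalerA.
by rewrite mulVf ?scale1r ?pnatr_eq0.
Qed.

Lemma size_chebT_prim n : (size (chebT_prim n) <= n.*2.+2)%N.
Proof.
case: n => [|n]; first by rewrite size_polyX.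
rewrite (leq_trans (size_scale_leq _ _))// (leq_trans (size_polyD _ _))//.
rewrite size_polyN geq_max; apply/andP; split.
  by rewrite (leq_trans (size_scale_leq _ _))// size_chebT.
rewrite (leq_trans (size_scale_leq _ _))//.
by apply: (leq_trans (size_chebT _)); lia.
Qed.

Lemma chebT_prim_le n x : -1 <= x <= 1 ->
  `|(chebT_prim n.+1).[x]| <= n.+1%:R^-1.
Proof.
move=> x1; rewrite /chebT_prim hornerZ normrM hornerD hornerN !hornerZ.
rewrite ger0_norm ?invr_ge0// mulrC ler_pdivrMr//.
apply: (le_trans (ler_normB _ _)); rewrite !normrM mulr_natr mulr2n.
apply: lerD; rewrite -[leRHS]mulr1 ler_pM ?chebT_le1// ger0_norm ?invr_ge0//;
  by rewrite lef_pV2 ?posrE ?ltr0n// ler_nat -?addnn; lia.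
Qed.

(** Integration goes mode by mode, [V] keeping the modes up to [D]. A dropped mode has index at
    least [D + 1], whence the extra factor [1 / (D + 1)] over [cheb_exp_trunc]. *)
Lemma cheb_exp_trunc_prim u D p B : 1 <= u -> cheb_exp u p B ->
  exists W V : {poly R}, [/\ W^`() = p \Po ('X^2 *+ 2 - 1),
    (size V <= D.*2.+2)%N &
    forall x, -1 <= x <= 1 -> `|W.[x] - V.[x]| <= B * u ^- D / D.+1%:R].
Proof.
move=> u1; have u0 : 0 < u by apply: lt_le_trans u1.
have u0' := ltW u0.
elim=> [n|{}p q {}B B' _ [W [V [dW sV HV]]] _ [W' [V' [dW' sV' HV']]]|
        a {}p {}B _ [W [V [dW sV HV]]]].
- have [nD|Dn] := leqP n D.
    exists (chebT_prim n), (chebT_prim n); split; first exact: deriv_chebT_prim.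
      by rewrite (leq_trans (size_chebT_prim n))// ltnS ltnS leq_double.
    by move=> x _; rewrite subrr normr0 !mulr_ge0 ?addr_ge0 ?invr_ge0 ?exprn_ge0.
  exists (chebT_prim n), 0; split=> [||x x1]; first exact: deriv_chebT_prim.
    by rewrite size_poly0.
  case: n Dn => // n Dn.
  rewrite horner0 subr0 (le_trans (chebT_prim_le _ _ x1))//.
  rewrite -[leLHS]mul1r ler_pM// ?ler01 ?invr_ge0//; last first.
    by rewrite lef_pV2 ?posrE ?ltr0n// ler_nat.
  rewrite ler_pdivlMr ?exprn_gt0//.
  by rewrite mul1r ler_wpDr ?invr_ge0 ?exprn_ge0 ?ler_weXn2l// ltnW.
- exists (W + W'), (V + V'); split=> [||x x1].
  + by rewrite derivD dW dW' comp_polyD.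
  + by rewrite (leq_trans (size_polyD _ _))// geq_max sV.
  rewrite !hornerD !mulrDl opprD addrACA (le_trans (ler_normD _ _))//.
  by rewrite lerD ?HV ?HV'.
- exists (a *: W), (a *: V); split=> [||x x1].
  + by rewrite derivZ dW comp_polyZ.
  + by rewrite (leq_trans (size_scale_leq _ _)).
  by rewrite !hornerZ -mulrBr normrM -!mulrA ler_wpM2l// mulrA HV.
Qed.

(** Start from [T_0 = 1], of weight 2, and take [n] steps of the walk. *)
Lemma cheb_expXn u n : 0 < u -> cheb_exp u 'X^n (2 * ((u + u^-1) / 2) ^+ n).
Proof.
move=> u0; elim: n => [|n IH].
  rewrite !expr0 mulr1 (_ : 2 = u ^+ 0 + u ^- 0); first exact: (cheb_expT u 0).
  by rewrite expr0 invr1.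
by rewrite !exprS mulrCA; apply: cheb_expMX.
Qed.

Lemma cheb_exp_sum u (a : nat -> R) n : 0 < u ->
  cheb_exp u (\sum_(i < n) a i *: 'X^i)
             (2 * \sum_(i < n) `|a i| * ((u + u^-1) / 2) ^+ i).
Proof.
move=> u0; elim: n => [|n IH].
  by have := cheb_expZ u 0 _ _ (cheb_expXn u 0 u0);
    rewrite !big_ord0 scale0r normr0 mul0r mulr0.
rewrite !big_ord_recr /= mulrDr; apply: cheb_expD => //.
by rewrite mulrCA; apply/cheb_expZ/cheb_expXn.
Qed.
End Chebyshev.

(** * Chernoff bounds and Taylor sums of the exponential *)

Section Tail.
Context {R : realType}.
Implicit Types (d r t u x y L : R) (K : nat).

Lemma ln2_ge_half : 1 / 2 <= ln (2 : R).
Proof.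
rewrite -ler_expR lnK ?posrE//.
have := expR_ge1Dx (- (1 / 2) : R); rewrite expRN => h.
have : expR (1 / 2 : R) * (expR (1 / 2))^-1 = 1 by rewrite divff// expR_eq0.
have := expR_gt0 (1 / 2 : R); nra.
Qed.

(** From [exp(-t/2) >= 1 - t/2] and [(1 + t)(1 - t/2) >= 1], the latter because [t <= 1]. *)
Lemma expR_half_le t : 0 <= t <= 1 -> expR (t / 2) <= 1 + t.
Proof.
move=> /andP[t0 t1]; have := expR_ge1Dx (- (t / 2)); rewrite expRN => h.
have : expR (t / 2) * (expR (t / 2))^-1 = 1 by rewrite divff// expR_eq0.
have := expR_gt0 (t / 2); nra.
Qed.

(* Chernoff's bound with [u = 1 + t] and [t = sqrt (L / d)]. *)
Lemma chernoff_tail K L d : ln 2 <= L -> L <= d ->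
  exists u D, [/\ 1 <= u,
    Num.sqrt (d * L) <= D%:R <= (2 * K + 5)%:R * Num.sqrt (d * L) &
    forall r, 0 <= r <= d ->
      2 * expR (r * ((u + u^-1) / 2 - 1)) * u ^- D <= expR (- L) ^+ K].
Proof.
move=> L2 Ld; have Lh := le_trans ln2_ge_half L2.
have L0 : 0 < L by lra.
have d0 : 0 < d by lra.
set s := Num.sqrt (d * L).
have ss : s * s = d * L by rewrite -expr2 sqr_sqrtr// mulr_ge0 ?ltW.
have sL : L <= s.
  by rewrite -ler_sqr ?nnegrE ?sqrtr_ge0 ?(ltW L0)// !expr2 ss ler_pM2r.
have s0 : 0 < s by lra.
pose t := L / s.
have ts : t * s = L by rewrite /t divfK ?gt_eqF.
have t01 : 0 <= t <= 1 by rewrite ler_pdivrMr// mul1r sL divr_ge0 ?(ltW L0) ?(ltW s0).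
have dtt : d * t * t = L.
  apply: (mulIf (lt0r_neq0 L0)); rewrite -[RHS]/(L * L) -{2 3}ts -mulrA; ring: ss.
(* As [t s = L], this gives [(1 + t)^-D <= exp(-(2K + 3) L / 2)]. The 3 pays for the prefactor
   [2 <= exp L] and for the moment [exp(L / 2)], leaving [exp(-K L)]. *)
pose D := (Num.trunc ((2 * K + 3)%:R * s)).+1.
have c0 : 0 <= (2 * K + 3)%:R * s by rewrite mulr_ge0 ?ltW.
have /andP[D1 D2] := truncn_itv c0.
have Ds : s <= D%:R.
  by apply: le_trans _ (ltW D2); rewrite ler_peMl ?(ltW s0)// ler1n addn3.
(* The upper bound on [D] uses [1 <= 2 s], from [s >= L >= 1/2]. The lower bound serves
   [erf_approx], where [1 / (D + 1)] has to absorb [lambda]. *)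
exists (1 + t), D; split.
- by have /andP[] := t01; lra.
- rewrite Ds /= /D -addn1 natrD (le_trans (lerD D1 (lexx 1)))//.
  by rewrite !natrD !mulrDl; lra.
move=> r /andP[r0 rd].
have /andP[t0 t1] := t01.
have u0 : 0 < 1 + t by lra.
(* The left side equals [t^2 / (2 (1 + t))]; with [r <= d] and [d t^2 = L] the exponent is at most
   [L / 2]. *)
have cE : (1 + t + (1 + t)^-1) / 2 - 1 <= t * t / 2.
  have : (1 + t) * (1 + t)^-1 = 1 by rewrite divff ?gt_eqF.
  have : 0 < (1 + t)^-1 by rewrite invr_gt0.
  nra.
have rE : expR (r * ((1 + t + (1 + t)^-1) / 2 - 1)) <= expR (L / 2).
  rewrite ler_expR; apply: le_trans (ler_wpM2l r0 cE) _.
  have : 0 <= t * t by rewrite mulr_ge0.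
  by move: dtt; nra.
have DE : (1 + t) ^- D <= expR (- ((2 * K + 3)%:R * L / 2)).
  rewrite expRN lef_pV2 ?posrE ?expR_gt0 ?exprn_gt0//.
  have : expR (D%:R * (t / 2)) <= (1 + t) ^+ D.
    by rewrite expRM_natl lerXn2r ?nnegrE ?expR_ge0 ?(ltW u0) ?expR_half_le.
  apply: le_trans; rewrite ler_expR -ts.
  by have := ler_wpM2l t0 (ltW D2); rewrite -/D; lra.
have E2 : 2 <= expR L by rewrite -[leLHS]lnK ?posrE// ler_expR.
have u0' := ltW u0.
apply: le_trans (ler_pM _ _ (ler_pM _ _ E2 rE) DE) _;
  rewrite ?mulr_ge0 ?expR_ge0 ?invr_ge0 ?exprn_ge0//.
rewrite -!expRD -expRM_natl ler_expR natrD natrM; lra.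
Qed.

Lemma exp_partial_le x n : 0 <= x -> \sum_(i < n) x ^+ i / i`!%:R <= expR x.
Proof.
have <- : series (exp_coeff x) n = \sum_(i < n) x ^+ i / i`!%:R.
  by rewrite seriesEord.
move=> x0.
apply: (@nondecreasing_cvgn_le R _ _ (is_cvg_series_exp_coeff x)) => m k mk.
rewrite -subr_ge0 sub_series_geq// sumr_ge0// => i _.
by rewrite /exp_coeff /= divr_ge0 ?exprn_ge0.
Qed.

(** The Taylor remainder at [y] is dominated term by term by the one at [x]. The infinite remainder
    is replaced by a finite one, up to an arbitrary [e]. *)
Lemma exp_partial_dist x y n : `|y| <= x ->
  `|expR y - \sum_(i < n) y ^+ i / i`!%:R| <=
    expR x - \sum_(i < n) x ^+ i / i`!%:R.
Proof.
move=> yx; have x0 : 0 <= x by apply: le_trans yx.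
apply/ler_addgt0Pr => e e0.
have : \forall m \near \oo, `|expR y - series (exp_coeff y) m| < e.
  exact: cvgr_dist_lt (is_cvg_series_exp_coeff y) e e0.
case=> m _ Hm; set M := maxn m n.
have {Hm} HM := Hm M (leq_maxl m n).
have nM : (n <= M)%N := leq_maxr m n.
apply: le_trans (ler_distD (series (exp_coeff y) M) _ _) _.
rewrite addrC; apply: lerD; last exact: ltW.
have SE z : \sum_(i < n) z ^+ i / i`!%:R = series (exp_coeff z) n.
  by rewrite seriesEord.
rewrite !SE.
rewrite sub_series_geq//; apply: le_trans (ler_norm_sum _ _ _) _.
have hM : series (exp_coeff x) M <= expR x by rewrite seriesEord exp_partial_le.
apply: le_trans (lerB hM (lexx (series (exp_coeff x) n))).
rewrite sub_series_geq// ler_sum// => i _.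
rewrite /exp_coeff /= normrM normrX (@ger0_norm _ i`!%:R^-1) ?invr_ge0//.
by rewrite ler_wpM2r ?invr_ge0// lerXn2r ?nnegrE.
Qed.

(* A Taylor partial sum: the weights of the [(- x)^i] are those of a Poisson law. *)
Lemma cheb_exp_exp_fun beta u e : 0 <= beta -> 0 < u -> 0 < e ->
  exists (p : {poly R}) B, [/\ cheb_exp u p B,
    B <= 2 * expR (beta * ((u + u^-1) / 2 - 1)) &
    forall x, -1 <= x <= 1 -> `|exp_fun beta x - p.[x]| <= e].
Proof.
move=> b0 u0 e0.
(* The number [n] of terms may be huge: the bound on [B] does not depend on it, and truncating the
   expansion later reduces the degree. *)
have : \forall m \near \oo, `|expR beta - series (exp_coeff beta) m| < e.
  exact: cvgr_dist_lt (is_cvg_series_exp_coeff beta) e e0.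
case=> n _ /(_ n (leqnn n)); rewrite seriesEord => Hn.
pose a i : R := expR (- beta) * ((- beta) ^+ i / i`!%:R).
exists (\sum_(i < n) a i *: 'X^i), (2 * \sum_(i < n) `|a i| * ((u + u^-1) / 2) ^+ i).
split.
- exact: cheb_exp_sum.
(* The Poisson generating function: with [c = (u + u^-1) / 2], the partial sums of
   [exp(-beta) (beta c)^i / i!] stay below [exp(beta (c - 1))]. *)
- rewrite ler_pM2l// mulrBr mulr1 expRD [leRHS]mulrC.
  have c0 : 0 <= beta * ((u + u^-1) / 2).
    by have u0w := ltW u0; rewrite mulr_ge0 ?divr_ge0 ?addr_ge0 ?invr_ge0.
  apply: le_trans _ (ler_wpM2l (expR_ge0 _) (exp_partial_le _ n c0)).
  rewrite mulr_sumr ler_sum// => i _; rewrite /a normrM (ger0_norm (expR_ge0 _)).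
  rewrite normrM normrX normrN (ger0_norm b0) (@ger0_norm _ i`!%:R^-1) ?invr_ge0//.
  by rewrite -!mulrA ler_wpM2l ?expR_ge0// [in leRHS]exprMn -mulrA (mulrC _^-1).
move=> x /andP[x0 x1].
have -> : exp_fun beta x = expR (- beta) * expR (- beta * x).
  by rewrite /exp_fun mulrDr mulr1 expRD.
have -> : (\sum_(i < n) a i *: 'X^i).[x] =
    expR (- beta) * \sum_(i < n) (- beta * x) ^+ i / i`!%:R.
  rewrite horner_sum mulr_sumr; apply: eq_bigr => i _.
  by rewrite hornerZ hornerXn /a exprMn -!mulrA (mulrC _^-1).
rewrite -mulrBr normrM ger0_norm ?expR_ge0//.
have yb : `|- beta * x| <= beta.
  by rewrite normrM normrN (ger0_norm b0) ler_piMr// ler_norml x0.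
have e1 : expR (- beta) <= 1 by rewrite expR_le1 oppr_le0.
apply: le_trans (ler_wpM2r (normr_ge0 _) e1) _; rewrite mul1r.
apply: le_trans (exp_partial_dist _ _ n yb) _.
exact: le_trans (ler_norm _) (ltW Hn).
Qed.
End Tail.

(** * Oriented integrals through antiderivatives *)

Section OrientedIntegral.
Context {R : realType}.
Implicit Types (a b x : R) (f g F G : R -> R).

Lemma Rintegral_FTC2 f F a b : a <= b -> continuous f ->
  (forall x, is_derive x (1 : R) F (f x)) ->
  Rintegral lebesgue_measure `[a, b] f = F b - F a.
Proof.
rewrite le_eqVlt => /predU1P[-> _ _|ab cf dF].
  by rewrite set_itv1 Rintegral_set1 subrr.
have DF x : derivable F x 1 by apply: ex_derive.
have cF : continuous F.
  by move=> x; apply/differentiable_continuous/derivable1_diffP.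
rewrite /Rintegral (continuous_FTC2 (F := F))//.
- exact: continuous_subspaceT.
- split; first by move=> x _; exact: DF.
  + exact/cvg_at_right_filter/cF.
  + exact/cvg_at_left_filter/cF.
- by move=> x _; rewrite derive1E; apply: derive_val.
Qed.

Lemma integrable_itv f a b : continuous f ->
  lebesgue_measure.-integrable `[a, b] (EFin \o f).
Proof.
move=> cf; apply: continuous_compact_integrable; first exact: segment_compact.
exact: continuous_subspaceT.
Qed.

Lemma oriented_integralB f g G x : continuous f -> continuous g ->
  (forall x, is_derive x (1 : R) G (g x)) ->
  oriented_integral 0 x (f \- g) = oriented_integral 0 x f - (G x - G 0).
Proof.
move=> cf cg dG; rewrite /oriented_integral; case: ifPn => [x0|].
  rewrite -(Rintegral_FTC2 _ _ _ _ x0 cg dG).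
  by rewrite RintegralB//; apply: integrable_itv.
rewrite -ltNge => /ltW x0; rewrite -[G x - _]opprB -(Rintegral_FTC2 _ _ _ _ x0 cg dG).
by rewrite RintegralB//; [rewrite opprB opprK addrC | apply: integrable_itv..].
Qed.

(** The norm on the right covers both orientations. Applied with [g] a constant error, and with [g]
    the derivative of an arctangent. *)
Lemma oriented_integral_le f g G x : -1 <= x <= 1 -> continuous f -> continuous g ->
  (forall x, is_derive x (1 : R) G (g x)) ->
  (forall u, -1 <= u <= 1 -> `|f u| <= g u) ->
  `|oriented_integral 0 x f| <= `|G x - G 0|.
Proof.
move=> /andP[xN1 x1] cf cg dG fg.
have H a b : a <= b -> -1 <= a -> b <= 1 ->
    `|Rintegral lebesgue_measure `[a, b] f| <= `|G b - G a|.
  move=> ab a1 b1; rewrite -(Rintegral_FTC2 _ _ _ _ ab cg dG).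
  have cnf : continuous (fun t => `|f t|).
    by move=> t; apply: cvg_norm; exact: cf.
  have mab : measurable `[a, b] by exact: measurable_itv.
  apply: (@le_trans _ _ (\int[lebesgue_measure]_(t in `[a, b]) `|f t|)).
    by apply: le_normr_Rintegral; [exact: mab | exact: integrable_itv].
  apply: le_trans _ (ler_norm _); apply: le_Rintegral => //.
  - exact: (integrable_itv _ a b cnf).
  - exact: integrable_itv.
  - move=> t /=; rewrite in_itv /= => /andP[at_ tb]; apply: fg.
    by rewrite (le_trans a1 at_) (le_trans tb b1).
rewrite /oriented_integral; case: ifPn => [x0|]; first exact: H.
by rewrite -ltNge => /ltW x0; rewrite normrN distrC; apply: H.
Qed.
End OrientedIntegral.

(** * Approximation of each function class, with [exp(-L)] in the role of [delta] *)

Section Classes.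
Context {R : realType}.
Implicit Types (f : R -> R) (x beta gamma lambda L e : R) (K D n : nat).

Definition poly_approx f D e :=
  exists2 p : {poly R}, (size p <= D.+1)%N &
    forall x, -1 <= x <= 1 -> `|f x - p.[x]| <= e.

(** One extra power of [exp(-L) <= 1/2] buys a factor 2 in the error. *)
Lemma expRN_pow_half L K : ln 2 <= L ->
  expR (- L) ^+ K.+1 <= expR (- L) ^+ K / 2.
Proof.
move=> L2; have E2 : 2 <= expR L by rewrite -[leLHS]lnK ?posrE// ler_expR.
rewrite exprS mulrC ler_wpM2l ?exprn_ge0 ?expR_ge0//.
by rewrite expRN lef_pV2 ?posrE ?expR_gt0.
Qed.

(** By [1 + v <= exp v]. It puts a walk of fixed length in the Poisson form that [chernoff_tail]
    handles. *)
Lemma cosh_pow_le u n : 0 < u ->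
  ((u + u^-1) / 2) ^+ n <= expR (n%:R * ((u + u^-1) / 2 - 1)) :> R.
Proof.
move=> u0; have u0' := ltW u0; have c0 : 0 <= (u + u^-1) / 2.
  by rewrite divr_ge0 ?addr_ge0 ?invr_ge0.
rewrite expRM_natl lerXn2r ?nnegrE ?expR_ge0//.
by apply: le_trans _ (expR_ge1Dx _); rewrite addrCA subrr addr0.
Qed.

Lemma monomial_approx K L n : ln 2 <= L ->
  exists2 D, D%:R <= (2 * K + 5)%:R * Num.sqrt (n%:R * L) &
    poly_approx (monomial_fun n) D (expR (- L) ^+ K).
Proof.
move=> L2; have [Ln|nL] := leP L n%:R.
  have [u [D [u1 /andP[_ hD] hB]]] := chernoff_tail K L n%:R L2 Ln.
  have u0 : 0 < u by apply: lt_le_trans u1.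
  exists D => //.
  have [q sq hq] := cheb_exp_trunc u D _ _ u1 (cheb_expXn u n u0).
  exists q => // x x1; rewrite /monomial_fun -[x ^+ n]hornerXn.
  apply: le_trans (hq x x1) (le_trans _ (hB n%:R _)); last by rewrite ler0n lexx.
  have u0' := ltW u0.
  by rewrite ler_wpM2r ?invr_ge0 ?exprn_ge0// ler_wpM2l ?cosh_pow_le.
(* Here [n < L], so [n <= sqrt (n L)] and the monomial is its own approximation. *)
exists n.
  have n0 : 0 <= n%:R :> R by rewrite ler0n.
  apply: (@le_trans _ _ (Num.sqrt (n%:R * L))).
    rewrite -[leLHS]ger0_norm// -sqrtr_sqr ler_wsqrtr// expr2 ler_wpM2l//.
    exact: ltW.
  by rewrite ler_peMl ?sqrtr_ge0// ler1n addnS.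
exists 'X^n; first by rewrite size_polyXn.
by move=> x _; rewrite hornerXn subrr normr0 exprn_ge0 ?expR_ge0.
Qed.

Lemma exp_approx K L beta : ln 2 <= L -> 0 <= beta ->
  exists2 D, D%:R <= (2 * K + 7)%:R * Num.sqrt ((beta + L) * L) &
    poly_approx (exp_fun beta) D (expR (- L) ^+ K).
Proof.
move=> L2 b0; have Lh := le_trans ln2_ge_half L2.
have Ld : L <= beta + L by rewrite lerDr.
(* With exponent [K + 1] the truncation costs half of [exp(-L)^K]; the Taylor sum gets the other
   half. *)
have [u [D [u1 /andP[_ hD] hB]]] := chernoff_tail K.+1 L _ L2 Ld.
have u0 : 0 < u by apply: lt_le_trans u1.
exists D; first by rewrite (_ : 2 * K + 7 = 2 * K.+1 + 5)%N//; lia.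
have e0 : 0 < expR (- L) ^+ K / 2 by rewrite divr_gt0 ?exprn_gt0 ?expR_gt0.
have [p [B [Ep hBp hp]]] := cheb_exp_exp_fun beta u _ b0 u0 e0.
have [q sq hq] := cheb_exp_trunc u D _ _ u1 Ep.
exists q => // x x1.
apply: le_trans (ler_distD p.[x] _ _) _.
rewrite (splitr (_ ^+ K)); apply: lerD; first exact: hp.
apply: le_trans (hq x x1) _; apply: le_trans _ (expRN_pow_half _ _ L2).
apply: le_trans _ (hB beta _); last by rewrite b0 lerDl; lra.
by rewrite ler_wpM2r ?invr_ge0 ?exprn_ge0 ?(ltW u0).
Qed.

Lemma gaussian_exp_fun gamma x :
  gaussian_fun gamma x = exp_fun (gamma ^+ 2 / 2) (x ^+ 2 *+ 2 - 1).
Proof. by rewrite /gaussian_fun /exp_fun; congr expR; field. Qed.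

Lemma size_comp_double (p : {poly R}) D : (size p <= D.+1)%N ->
  (size (p \Po ('X^2 *+ 2 - 1)) <= D.*2.+1)%N.
Proof.
move=> sp; have s3 : size ('X^2 *+ 2 - 1 : {poly R}) = 3.
  rewrite -scaler_nat size_polyDl size_scale ?pnatr_eq0// size_polyXn//.
  by rewrite size_polyN size_poly1.
apply: leq_trans (size_comp_poly_leq _ _) _; rewrite s3.
by rewrite ltnS muln2 leq_double; case: (size p) sp.
Qed.

Lemma horner_comp_double (p : {poly R}) x :
  (p \Po ('X^2 *+ 2 - 1)).[x] = p.[x ^+ 2 *+ 2 - 1].
Proof. by rewrite horner_comp hornerD hornerN hornerC hornerMn hornerXn. Qed.

Lemma gaussian_approx K L gamma : ln 2 <= L ->
  exists2 D, D%:R <= (4 * K + 14)%:R * Num.sqrt ((gamma ^+ 2 + L) * L) &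
    poly_approx (gaussian_fun gamma) D (expR (- L) ^+ K).
Proof.
move=> L2; have Lh := le_trans ln2_ge_half L2.
have g0 : 0 <= gamma ^+ 2 / 2 by rewrite divr_ge0 ?sqr_ge0.
have [D hD [p sp hp]] := exp_approx K L _ L2 g0.
exists D.*2.
  have -> : (4 * K + 14)%:R = 2 * (2 * K + 7)%:R :> R.
    by rewrite -natrM; congr _%:R; lia.
  rewrite -muln2 natrM mulrC -mulrA ler_wpM2l//.
  apply: le_trans hD _; rewrite ler_wpM2l// ler_wsqrtr//.
  have := sqr_ge0 gamma; nra.
exists (p \Po ('X^2 *+ 2 - 1)); first exact: size_comp_double.
by move=> x x1; rewrite gaussian_exp_fun horner_comp_double hp// unit_comp.
Qed.

Lemma continuous_scaled_sqr lambda : continuous (fun x => (lambda * x) ^+ 2).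
Proof.
have -> : (fun x => (lambda * x) ^+ 2) = horner ((lambda *: 'X) ^+ 2).
  by apply/funext => x; rewrite horner_exp hornerZ hornerX.
by move=> x; apply: continuous_horner.
Qed.

Lemma continuous_gaussian lambda : continuous (gaussian_fun lambda).
Proof.
move=> x; rewrite /gaussian_fun; apply: continuous_comp; last exact: continuous_expR.
by apply: cvgN; apply: continuous_scaled_sqr.
Qed.

Lemma sqrt_pi_itv : 1 <= Num.sqrt (pi : R) <= 2.
Proof.
have := @pi_ge2 R; have := @pihalf_lt2 R => h1 h2.
have s0 := sqrtr_ge0 (pi : R).
have ss : Num.sqrt (pi : R) ^+ 2 = pi by rewrite sqr_sqrtr// pi_ge0.
by apply/andP; split; nra.
Qed.

(** Since [exp(-v) <= 1 / (1 + v)] for [v >= 0], an arctangent dominates the integral, without the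
    value of the Gaussian integral: the bound is [(2 / sqrt pi) (pi / 2) = sqrt pi <= 2]. *)
Lemma erf_bound lambda x : 0 < lambda -> -1 <= x <= 1 -> `|erf_fun lambda x| <= 2.
Proof.
move=> l0 x1; rewrite /erf_fun.
have /andP[sp1 sp2] := sqrt_pi_itv.
have s0 : 0 < Num.sqrt (pi : R) by lra.
have ss : Num.sqrt (pi : R) * Num.sqrt pi = pi by rewrite -expr2 sqr_sqrtr// pi_ge0.
pose g (u : R) := (1 + (lambda * u) ^+ 2)^-1.
pose G (u : R) := lambda^-1 * atan (lambda * u).
have g1 u : 1 + (lambda * u) ^+ 2 != 0.
  by rewrite gt_eqF// ltr_pwDl// sqr_ge0.
have cg : continuous g.
  move=> u; apply: cvgV => //; apply: cvgD; first exact: cvg_cst.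
  exact: continuous_scaled_sqr.
have dG u : is_derive u (1 : R) G (g u).
  have d1 : is_derive u (1 : R) (fun v => lambda * v) lambda.
    by apply: is_derive_eq; rewrite /GRing.scale /= mulr1 ?mulr0 ?scaler0 ?addr0 ?add0r.
  have d2 := is_derive1_comp (is_derive1_atan (lambda * u)) d1.
  have -> : g u = lambda^-1 *: ((1 + (lambda * u) ^+ 2)^-1 * lambda).
    by rewrite /g /GRing.scale /= mulrCA mulVf ?mulr1 ?gt_eqF.
  exact: is_deriveZ.
have fg u : -1 <= u <= 1 -> `|gaussian_fun lambda u| <= g u.
  move=> _; rewrite ger0_norm ?expR_ge0// /gaussian_fun expRN.
  by rewrite lef_pV2 ?posrE ?expR_gt0 ?expR_ge1Dx// ltr_pwDl// sqr_ge0.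
have := oriented_integral_le _ _ _ _ x1 (continuous_gaussian lambda) cg dG fg.
rewrite /G mulr0 atan0 mulr0 subr0 => H.
have a0 : 0 <= 2 * lambda / Num.sqrt pi by rewrite divr_ge0 ?mulr_ge0 ?ltW.
rewrite normrM ger0_norm//; apply: le_trans (ler_wpM2l a0 H) _.
rewrite normrM gtr0_norm ?invr_gt0//.
have ha : `|atan (lambda * x)| <= pi / 2.
  by rewrite ler_norml (ltW (atan_gtNpi2 _)) (ltW (atan_ltpi2 _)).
have -> : 2 * lambda / Num.sqrt pi * (lambda^-1 * `|atan (lambda * x)|) =
    2 * `|atan (lambda * x)| / Num.sqrt pi.
  by field; rewrite !gt_eqF.
rewrite ler_pdivrMr//; nra.
Qed.

Lemma erf_approx K L lambda : ln 2 <= L -> 0 < lambda ->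
  exists2 D, D%:R <= (4 * K + 28)%:R * Num.sqrt ((lambda ^+ 2 + L) * L) &
    poly_approx (erf_fun lambda) D (expR (- L) ^+ K).
Proof.
move=> L2 l0; have Lh := le_trans ln2_ge_half L2.
have L0 : 0 < L by lra.
have l20 := sqr_ge0 lambda.
have Ld : L <= lambda ^+ 2 + L by rewrite lerDr.
set s := Num.sqrt _.
have s0 : 0 <= s by apply: sqrtr_ge0.
have ss : s * s = (lambda ^+ 2 + L) * L.
  by rewrite -expr2 sqr_sqrtr// mulr_ge0 ?(ltW L0)// (le_trans (ltW L0) Ld).
have s1 : 1 <= 2 * s by nra.
have sl : lambda <= 2 * s by nra.
(* Four extra powers give a factor [1/16], for the two endpoint errors and the bound
   [lambda / (D + 1) <= 2] below. *)
have [u [D [u1 /andP[hsD hD] hB]]] := chernoff_tail (K + 4) L _ L2 Ld.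
rewrite -/s in hsD hD.
have u0 : 0 < u by apply: lt_le_trans u1.
set q := expR (- L); have q0 : 0 < q by apply: expR_gt0.
(* Chosen so that, after multiplication by the prefactor [a <= 2 lambda], this error is at most
   [q^K / 2]. *)
have e0 : 0 < q ^+ K / (4 * (lambda + 1)).
  by rewrite divr_gt0 ?exprn_gt0// mulr_gt0// addr_gt0.
set e := _ / _ in e0.
have b0 : 0 <= lambda ^+ 2 / 2 by rewrite divr_ge0.
have [p [B [Ep hBp hp]]] := cheb_exp_exp_fun _ u _ b0 u0 e0.
have [W [V [dW sV hV]]] := cheb_exp_trunc_prim u D _ _ u1 Ep.
have {hBp hB} hB : B * u ^- D <= q ^+ (K + 4).
  apply: le_trans _ (hB (lambda ^+ 2 / 2) _); last by rewrite b0; lra.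
  by rewrite ler_wpM2r ?invr_ge0 ?exprn_ge0 ?(ltW u0).
have /andP[sp1 sp2] := sqrt_pi_itv.
set a := 2 * lambda / Num.sqrt pi.
have a0 : 0 <= a by rewrite divr_ge0 ?mulr_ge0 ?(ltW l0)//; lra.
have al : a <= 2 * lambda by rewrite ler_pdivrMr ?ler_peMr ?mulr_ge0 ?(ltW l0)//; lra.
(* [2 D + 1 <= 2 (2 (K + 4) + 5) s + 1 <= (4 K + 28) s], by [1 <= 2 s]. *)
exists D.*2.+1.
  rewrite -addn1 -muln2 natrD natrM (natrD _ (4 * K)) natrM.
  by move: hD; rewrite natrD natrM natrD; nra.
exists (a *: (V - (V.[0])%:P)).
  rewrite (leq_trans (size_scale_leq _ _))// (leq_trans (size_polyD _ _))//.
  by rewrite size_polyN geq_max sV (leq_trans (size_polyC_leq1 _)).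
move=> x x1; rewrite hornerZ hornerD hornerN hornerC.
(* The derivative of [W] is within [e] of the Gaussian on [-1, 1], and the interval of integration
   has length at most 1. *)
have H1 : `|oriented_integral 0 x (gaussian_fun lambda) - (W.[x] - W.[0])| <= e.
  have cW : continuous (horner W^`()) by move=> t; apply: continuous_horner.
  rewrite -(oriented_integralB _ _ _ _ (continuous_gaussian lambda) cW).
  have ce : continuous (fun _ : R => e) by exact: cst_continuous.
  have cgW : continuous (gaussian_fun lambda \- horner W^`()).
    by move=> t; apply: continuousB; [exact: continuous_gaussian|exact: cW].
  apply: le_trans
    (oriented_integral_le _ (fun=> e) (horner (e *: 'X)) _ x1 cgW ce _ _) _.
  - by move=> t; apply: is_derive_eq; rewrite derivZ derivX hornerZ hornerC mulr1.
  - move=> t t1 /=; rewrite dW horner_comp_double gaussian_exp_fun.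
    by apply: hp; apply: unit_comp.
  rewrite !hornerZ !hornerX mulr0 subr0 normrM ger0_norm ?(ltW e0)//.
  by rewrite ler_piMr ?(ltW e0)// ler_norml.
have D0 : 0 < D.+1%:R :> R by rewrite ltr0n.
have H2 y : -1 <= y <= 1 -> `|W.[y] - V.[y]| <= q ^+ (K + 4) / D.+1%:R.
  by move=> y1; apply: le_trans (hV y y1) _; rewrite ler_pM2r ?invr_gt0.
have H20 : `|W.[0] - V.[0]| <= q ^+ (K + 4) / D.+1%:R by apply: H2; lra.
have {hV} H2x := H2 x x1.
have qq : q ^+ (K + 4) <= q ^+ K / 16.
  rewrite addn4; have h := fun k => expRN_pow_half L k L2.
  have := h K; have := h K.+1; have := h K.+2; have := h K.+3; rewrite -/q; lra.
rewrite /erf_fun -/(gaussian_fun lambda) -/a -mulrBr normrM (ger0_norm a0).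
set I := oriented_integral _ _ _ in H1 *.
have H3 : `|I - (V.[x] - V.[0])| <= e + 2 * (q ^+ K / 16 / D.+1%:R).
  have H4 : q ^+ (K + 4) / D.+1%:R <= q ^+ K / 16 / D.+1%:R.
    by rewrite ler_pM2r ?invr_gt0.
  move: H1 H20 H2x H4; rewrite !ler_norml.
  move: (q ^+ (K + 4) / _) (q ^+ K / 16 / _) (W.[x]) (W.[0]) (V.[x]) (V.[0]).
  by move=> ? ? ? ? ? ? /andP[? ?] /andP[? ?] /andP[? ?] ?; apply/andP; split; lra.
apply: le_trans (ler_wpM2l a0 H3) _.
have qK : 0 < q ^+ K by apply: exprn_gt0.
have ae : a * e <= q ^+ K / 2.
  have : e * (4 * (lambda + 1)) = q ^+ K.
    by rewrite divfK// gt_eqF// mulr_gt0// addr_gt0.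
  nra.
(* The gain from integration absorbs the prefactor: [lambda <= 2 s <= 2 D]. *)
have lD : lambda / D.+1%:R <= 2.
  by rewrite ler_pdivrMr// -natr1; nra.
rewrite mulrDr; have : a * (2 * (q ^+ K / 16 / D.+1%:R)) <= q ^+ K / 2.
  have -> : a * (2 * (q ^+ K / 16 / D.+1%:R)) = a / D.+1%:R * (q ^+ K / 8).
    by field; rewrite gt_eqF.
  have : a / D.+1%:R <= 4.
    apply: le_trans (_ : 2 * lambda / D.+1%:R <= _).
      by rewrite ler_pM2r ?invr_gt0.
    by rewrite -mulrA (_ : 4 = 2 * 2) ?ler_pM2l// -natrM.
  have q8 : 0 <= q ^+ K / 8 by rewrite divr_ge0 ?ltW.
  by move=> /(ler_wpM2r q8) /le_trans; apply; lra.
move: (a * (2 * _)) => ?; lra.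
Qed.
End Classes.

(** * Products of factors, trigonometric polynomials and the error budget *)

Section Assembly.
Context {R : realType}.
Implicit Types (f g : R -> R) (delta d : R) (K D : nat).

Lemma class_approx K delta f d : 0 < delta <= 1 / 2 -> fun_degree delta f d ->
  [/\ 0 <= d, forall x, -1 <= x <= 1 -> `|f x| <= 2 &
    exists2 D, D%:R <= (4 * K + 28)%:R * Num.sqrt (d * ln (1 / delta)) &
      poly_approx f D (delta ^+ K)].
Proof.
move=> /andP[d0 d1]; rewrite /fun_degree; set L := ln _ => fd.
have dE : delta = expR (- L).
  by rewrite /L ln_div ?posrE// ln1 sub0r opprK lnK ?posrE.
have L2 : ln 2 <= L.
  by rewrite ler_ln ?posrE ?divr_gt0// ler_pdivlMr//; lra.
have Lh := le_trans ln2_ge_half L2.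
(* The largest of the four class constants, that of erf, serves them all. *)
have weaken c h D s : (c <= 4 * K + 28)%N -> D%:R <= c%:R * Num.sqrt s ->
    eq_on_unit f h -> poly_approx h D (delta ^+ K) ->
    exists2 D, D%:R <= (4 * K + 28)%:R * Num.sqrt s &
      poly_approx f D (delta ^+ K).
  move=> cK hD fh [p sp hp]; exists D.
    by rewrite (le_trans hD)// ler_wpM2r ?sqrtr_ge0// ler_nat.
  by exists p => // x x1; rewrite fh ?hp// in_itv.
have expR_le2 (y : R) : y <= 0 -> `|expR y| <= 2.
  by move=> y0; rewrite ger0_norm ?expR_ge0// (@le_trans _ _ 1)// ?expR_le1// ler1n.
have inI (x : R) : -1 <= x <= 1 -> x \in `[(-1), 1] by rewrite in_itv.
case: fd => [[n fn ->]|[b [b0 fb ->]]|[c [c0 fc ->]]|[l [l0 fl ->]]].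
- have [D hD hp] := monomial_approx K L n L2; rewrite -dE in hp.
  split=> [//|x x1|]; last by apply: weaken hD fn hp; lia.
  rewrite fn ?inI// /monomial_fun normrX (@le_trans _ _ 1)// ?ler1n//.
  by rewrite exprn_ile1// ler_norml.
- have [D hD hp] := exp_approx K L b L2 (ltW b0); rewrite -dE in hp.
  split=> [|x x1|]; [lra| |by apply: weaken hD fb hp; lia].
  rewrite fb ?inI// expR_le2// mulNr oppr_le0 mulr_ge0 ?(ltW b0)//.
  by case/andP: x1 => x1 _; lra.
- have [D hD hp] := gaussian_approx K L c L2; rewrite -dE in hp.
  split=> [|x x1|]; [have := sqr_ge0 c; lra| |by apply: weaken hD fc hp; lia].
  by rewrite fc ?inI// expR_le2// oppr_le0 sqr_ge0.
- have [D hD hp] := erf_approx K L l L2 l0; rewrite -dE in hp.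
  split=> [|x x1|]; [have := sqr_ge0 l; lra| |by apply: weaken hD fl hp; lia].
  by rewrite fl ?inI// erf_bound.
Qed.

(** Telescoping: factors are exchanged one at a time, each exchange costing at most [e] times a
    power of [B]. *)
Lemma prod_dist (I : Type) (r : seq I) (a b : I -> R) (B e : R) : 1 <= B ->
  (forall i, `|a i| <= B) -> (forall i, `|b i| <= B) ->
  (forall i, `|a i - b i| <= e) ->
  `|\prod_(i <- r) a i - \prod_(i <- r) b i| <= (size r)%:R * e * B ^+ size r.
Proof.
move=> B1 aB bB ab; have B0 : 0 <= B by rewrite (le_trans ler01).
have pB s : `|\prod_(i <- s) b i| <= B ^+ size s.
  elim: s => [|i s IH]; first by rewrite big_nil normr1 expr0.
  by rewrite big_cons normrM /= exprS ler_pM.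
elim: r => [|i r IH]; first by rewrite !big_nil subrr normr0 !mul0r.
have e0 : 0 <= e by apply: le_trans (ab i).
have -> : \prod_(j <- i :: r) a j - \prod_(j <- i :: r) b j =
    a i * (\prod_(j <- r) a j - \prod_(j <- r) b j) +
    (a i - b i) * \prod_(j <- r) b j by rewrite !big_cons; ring.
apply: le_trans (ler_normD _ _) _; rewrite !normrM /=.
apply: le_trans (lerD (ler_pM _ _ (aB i) IH) (ler_pM _ _ (ab i) (pB r))) _ => //.
rewrite exprS -natr1 !mulrDl mul1r.
rewrite mulrCA lerD2l ler_wpM2l// ler_peMl// exprn_ge0//.
Qed.

Lemma size_prod_le (I : Type) (r : seq I) (p : I -> {poly R}) (D : I -> nat) :
  (forall i, (size (p i) <= (D i).+1)%N) ->
  (size (\prod_(i <- r) p i)%R <= (\sum_(i <- r) D i).+1)%N.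
Proof.
move=> sp; elim: r => [|i r IH]; first by rewrite !big_nil size_poly1.
rewrite !big_cons (leq_trans (size_polyMleq _ _))//.
by have := sp i; move: IH; set a := size _; set b := size _; lia.
Qed.

(** Each [dg i] is at most the whole sum; the resulting factor [n] is harmless, the number of
    factors being a constant. *)
Lemma sum_sqrt_le n (D : 'I_n -> nat) (dg : 'I_n -> R) (c L : R) : 0 <= L ->
  0 <= c -> (forall i, 0 <= dg i) ->
  (forall i, (D i)%:R <= c * Num.sqrt (dg i * L)) ->
  (\sum_(i < n) D i)%:R <= n%:R * c * Num.sqrt ((\sum_(i < n) dg i) * L).
Proof.
move=> L0 c0 dg0 hD; rewrite natr_sum.
have -> : n%:R * c * Num.sqrt ((\sum_(i < n) dg i) * L) =
    \sum_(i < n) c * Num.sqrt ((\sum_(i < n) dg i) * L).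
  by rewrite sumr_const card_ord -[RHS]mulr_natl mulrA.
apply: ler_sum => i _; apply: le_trans (hD i) _; rewrite ler_wpM2l// ler_wsqrtr//.
rewrite ler_wpM2r// (bigD1 i)//= lerDl sumr_ge0//.
Qed.

(* [F y] is a Laurent polynomial in [expi y] with exponents in [-D, D]. *)
Definition trig_poly D (F : R -> R[i]) :=
  exists2 p : {poly R[i]}, (size p <= D.*2.+1)%N &
    forall y, F y * expi y ^+ D = p.[expi y].

Lemma trig_poly_cst (c : R[i]) : trig_poly 0 (fun=> c).
Proof.
exists c%:P => [|y]; first exact: size_polyC_leq1.
by rewrite hornerC mulr1.
Qed.

Lemma trig_polyM D E F G : trig_poly D F -> trig_poly E G ->
  trig_poly (D + E) (fun y => F y * G y).
Proof.
move=> [p sp hp] [q sq hq]; exists (p * q) => [|y].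
  by apply: leq_trans (size_polyMleq _ _) _; lia.
by rewrite hornerM -hp -hq exprD mulrACA.
Qed.

Lemma trig_polyD D F G : trig_poly D F -> trig_poly D G ->
  trig_poly D (fun y => F y + G y).
Proof.
move=> [p sp hp] [q sq hq]; exists (p + q) => [|y].
  by rewrite (leq_trans (size_polyD _ _))// geq_max sp.
by rewrite hornerD -hp -hq mulrDl.
Qed.

Lemma trig_poly_widen D E F : (D <= E)%N -> trig_poly D F -> trig_poly E F.
Proof.
move=> DE [p sp hp]; exists (p * 'X^(E - D)) => [|y].
  by apply: leq_trans (size_polyMleq _ _) _; rewrite size_polyXn; lia.
by rewrite hornerM hornerXn -hp -mulrA -exprD subnKC.
Qed.

Lemma trig_poly_cos : trig_poly 1 (fun y => (cos y)%:C).
Proof.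
exists (2^-1 *: ('X^2 + 1)) => [|y].
  rewrite (leq_trans (size_scale_leq _ _))// (leq_trans (size_polyD _ _))//.
  by rewrite size_polyXn size_poly1.
rewrite hornerZ hornerD hornerXn hornerC.
apply: (mulfI (_ : 2 != 0)); first by rewrite pnatr_eq0.
rewrite [RHS]mulrA divff ?mul1r ?pnatr_eq0//.
have := sin2cos2 y; rewrite /expi => E.
rewrite expr1 expr2; apply/eqP; rewrite eq_complex /=.
by apply/andP; split; apply/eqP; nra.
Qed.

Lemma trig_poly_sin : trig_poly 1 (fun y => (sin y)%:C).
Proof.
exists ((2 * 'i)^-1 *: ('X^2 - 1)) => [|y].
  rewrite (leq_trans (size_scale_leq _ _))// (leq_trans (size_polyD _ _))//.
  by rewrite size_polyXn size_polyN size_poly1.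
rewrite hornerZ hornerD hornerN hornerXn hornerC.
have i0 : 2 * 'i != 0 :> R[i] by rewrite mulf_neq0 ?pnatr_eq0 ?neq0Ci.
apply: (mulfI i0); rewrite [RHS]mulrA divff// mul1r.
have := sin2cos2 y; rewrite /expi => E.
rewrite expr1 expr2; apply/eqP; rewrite eq_complex /=.
by apply/andP; split; apply/eqP; nra.
Qed.

Lemma trig_poly_horner D (p : {poly R}) (X : R -> R) : (size p <= D.+1)%N ->
  trig_poly 1 (fun y => (X y)%:C) -> trig_poly D (fun y => (p.[X y])%:C).
Proof.
move=> sp hX; have hXn n : trig_poly n (fun y => (X y ^+ n)%:C).
  elim: n => [|n IH].
    by have := trig_poly_cst 1; congr (trig_poly _ _); apply/funext => y; rewrite expr0.
  have := trig_polyM _ _ _ _ hX IH; congr (trig_poly _ _); apply/funext => y.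
  by rewrite exprS rmorphM.
have -> : (fun y => (p.[X y])%:C) =
    (fun y => \sum_(i < D.+1) (p`_i)%:C * (X y ^+ i)%:C).
  apply/funext => y; rewrite (horner_coef_wide _ sp) rmorph_sum /=.
  by apply: eq_bigr => i _; rewrite rmorphM.
(* Only the number of terms varies in the induction; the exponent bound [D] stays fixed. *)
have : forall n, (n <= D.+1)%N ->
    trig_poly D (fun y => \sum_(i < n) (p`_i)%:C * (X y ^+ i)%:C); last exact.
elim=> [_|n IH nD].
  apply: (trig_poly_widen 0) => //; have := trig_poly_cst 0.
  by congr (trig_poly _ _); apply/funext => y; rewrite big_ord0.
under eq_fun do rewrite big_ord_recr.
apply: trig_polyD; first exact/IH/ltnW.
apply: (trig_poly_widen n) => //.
exact: trig_polyM (trig_poly_cst _) (hXn n).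
Qed.

Lemma trig_poly_prod n (D : 'I_n -> nat) (h : 'I_n -> R -> R) :
  (forall i, trig_poly (D i) (fun y => (h i y)%:C)) ->
  trig_poly (\sum_(i < n) D i) (fun y => (\prod_(i < n) h i y)%:C).
Proof.
elim: n D h => [|n IH] D h H.
  have := trig_poly_cst 1%:C; rewrite big_ord0.
  by congr (trig_poly _ _); apply/funext => y; rewrite big_ord0.
rewrite big_ord_recr.
have := trig_polyM _ _ _ _ (IH _ _ (fun i => H (widen_ord (leqnSn n) i))) (H ord_max).
by congr (trig_poly _ _); apply/funext => y; rewrite big_ord_recr rmorphM.
Qed.

Lemma norm_expi (y : R) : `|expi y| = 1.
Proof. by rewrite normc_def /= cos2Dsin2 sqrtr1. Qed.

(* Perturbing the vanishing coefficients secures nonzero extreme ones. *)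
Lemma trig_poly_laurent D F (e : R) : 0 < e -> trig_poly D F ->
  exists2 L : laurent R, laurent_degree L = D &
    forall y, `|F y - laurent_eval L (expi y)| <= e%:C.
Proof.
move=> e0 [p sp hp].
pose t := e / D.*2.+1%:R; have t0 : 0 < t by rewrite divr_gt0.
(* Each of the [2 D + 1] coefficients moves by at most [t], so the sum moves by at most [e] on the
   unit circle. *)
pose q k := if p`_k == 0 then t%:C else p`_k.
have q0 k : q k != 0.
  by rewrite /q; case: ifPn => // _; rewrite eq_complex /= negb_and gt_eqF.
have qp k : `|p`_k - q k| <= t%:C.
  rewrite /q; case: eqP => [->|_]; last by rewrite subrr normr0 lecR ltW.
  by rewrite sub0r normrN ger0_norm// lecR ltW.
(* For [k] in [-D, D] the shifted index is nonnegative, so [absz] leaves it unchanged. *)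
exists (@Laurent R D (fun k => q (absz (k + D%:Z))) (q0 _) (q0 _)) => // y.
set z := expi y; have nz : `|z| = 1 by apply: norm_expi.
have z0 : z != 0 by rewrite -normr_eq0 nz oner_eq0.
have -> : F y = \sum_(k < (2 * D).+1) p`_k * z ^ (k%:Z - D%:Z).
  apply: (mulIf (expf_neq0 D z0)); rewrite hp mulr_suml mul2n.
  rewrite (horner_coef_wide _ sp); apply: eq_bigr => k _.
  by rewrite -mulrA (exprnP z D) -expfzDr// subrK.
rewrite /laurent_eval /= -sumrB (le_trans (ler_norm_sum _ _ _))//.
have -> : e%:C = \sum_(k < (2 * D).+1) t%:C.
  rewrite sumr_const card_ord mul2n -[RHS]mulr_natr /t rmorphM /= fmorphV rmorph_nat.
  by rewrite divfK// pnatr_eq0.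
apply: ler_sum => k _; rewrite subrK -mulrBl normrM.
have -> : `|z ^ (k%:Z - D%:Z)| = 1.
  rewrite expfzDr// normrM -exprnP -exprnN normfV !normrX nz.
  by rewrite !expr1n invr1 mulr1.
by rewrite mulr1.
Qed.

Lemma laurent_rep_approx K delta g d : 0 < delta <= 1 / 2 ->
  laurent_rep_degree delta g d ->
  [/\ 0 <= d, forall y, `|g y| <= 2 &
    exists D (h : R -> R),
      [/\ D%:R <= (4 * K + 28)%:R * Num.sqrt (d * ln (1 / delta)),
        trig_poly D (fun y => (h y)%:C) &
        forall y, `|g y - h y| <= delta ^+ K]].
Proof.
move=> hd [f fd gE]; have [d0 f2 [D hD [p sp hp]]] := class_approx K delta f d hd fd.
have c1 (y : R) : -1 <= cos y <= 1 by rewrite cos_geN1 cos_le1.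
have s1 (y : R) : -1 <= sin y <= 1 by rewrite sin_geN1 sin_le1.
case: gE => ->; split=> // [y|]; rewrite ?f2//.
  exists D, (fun y => p.[cos y]); split=> // [|y]; last exact: hp.
  exact: trig_poly_horner sp trig_poly_cos.
exists D, (fun y => p.[sin y]); split=> // [|y]; last exact: hp.
exact: trig_poly_horner sp trig_poly_sin.
Qed.

(** The power [3 n] gives [8^-n], which beats [n 3^n <= 2^n 4^n]; the other two give
    [delta^2 <= delta / 2]. *)
Lemma error_budget n delta : 0 < delta <= 1 / 2 ->
  n%:R * delta ^+ (3 * n + 2) * 3 ^+ n <= delta / 2.
Proof.
move=> /andP[d0 d1]; have d0' := ltW d0.
have h8 : delta ^+ (3 * n) <= (8 ^+ n)^-1.
  rewrite exprM -exprVn lerXn2r ?nnegrE ?exprn_ge0 ?invr_ge0//.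
  have : delta ^+ 3 <= (1 / 2) ^+ 3 by rewrite lerXn2r ?nnegrE.
  by move/le_trans; apply; rewrite !exprS expr0; lra.
have n3 : n%:R * 3 ^+ n <= 8 ^+ n :> R.
  rewrite -!natrX -natrM ler_nat; rewrite (_ : 8 = 2 * 4)%N// expnMn.
  by apply: leq_mul; [exact/ltnW/ltn_expl | case: (n) => // m; rewrite leq_exp2r].
have d2 : delta ^+ 2 <= delta / 2 by rewrite expr2; nra.
have p8 : 0 < 8 ^+ n :> R by rewrite exprn_gt0.
rewrite exprD mulrAC mulrA mulrC -[leRHS]mulr1 ler_pM ?mulr_ge0 ?exprn_ge0//.
by apply: le_trans (ler_pM _ _ n3 h8) _; rewrite ?mulr_ge0 ?exprn_ge0 ?divff ?gt_eqF.
Qed.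
End Assembly.

Theorem theorem2 (R : realType) :
  exists delta0 : R, 0 < delta0 <= 1 / 2 /\
  forall N M : nat,
  exists C : R, 0 < C /\
  forall (f : 'I_N -> R -> R) (g : 'I_M -> R -> R)
         (delta : R) (df : 'I_N -> R) (dg : 'I_M -> R),
    0 < delta <= delta0 ->
    (forall i, F_all (f i)) ->
    (forall j, G_all (g j)) ->
    (forall i, fun_degree delta (f i) (df i)) ->
    (forall j, laurent_rep_degree delta (g j) (dg j)) ->
    let n_p := \sum_(i < N) df i in
    let m_p := \sum_(j < M) dg j in
    exists (P : {poly R}) (L : laurent R),
      [/\ (poly_degree P)%:R <= C * Num.sqrt (n_p * ln (1 / delta)),
          (laurent_degree L)%:R <= C * Num.sqrt (m_p * ln (1 / delta))
        & forall x y : R, -1 <= x <= 1 ->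
          `| ((\prod_(i < N) f i x) * (\prod_(j < M) g j y))%:C
             - (P.[x])%:C * laurent_eval L (expi y) | <= delta%:C].
Proof.
exists (1 / 2); split=> [|N M]; first by rewrite divr_gt0//=.
pose n := (N + M)%N; pose K := (3 * n + 2)%N; pose c : R := (4 * K + 28)%:R.
have c0 : 0 < c by rewrite ltr0n addn_gt0 orbT.
(* [n + 1] instead of [n] keeps the constant positive when there are no factors. *)
exists (n.+1%:R * c); split=> [|f g delta df dg hd _ _ hf hg n_p m_p].
  by rewrite mulr_gt0.
have /andP[d0 d1] := hd.
set L := ln (1 / delta).
have L0 : 0 <= L by rewrite ln_ge0// ler_pdivlMr//; lra.
have hf' i := class_approx K delta (f i) (df i) hd (hf i).
have hg' j := laurent_rep_approx K delta (g j) (dg j) hd (hg j).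
have /fin_all_exists[D /fin_all_exists[p hp]] : forall i, exists D (p : {poly R}),
    [/\ D%:R <= c * Num.sqrt (df i * L), (size p <= D.+1)%N &
      forall x, -1 <= x <= 1 -> `|f i x - p.[x]| <= delta ^+ K].
  by move=> i; have [_ _ [D hD [p sp hp]]] := hf' i; exists D, p.
have /fin_all_exists[E /fin_all_exists[h hh]] : forall j, exists E (h : R -> R),
    [/\ E%:R <= c * Num.sqrt (dg j * L), trig_poly E (fun y => (h y)%:C) &
      forall y, `|g j y - h y| <= delta ^+ K].
  by move=> j; have [_ _ H] := hg' j.
have scale k (s : R) : (k <= n)%N -> k%:R * c * Num.sqrt s <= n.+1%:R * c * Num.sqrt s.
  by move=> kn; rewrite ler_wpM2r ?sqrtr_ge0// ler_pM2r// ler_nat leqW.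
pose P := \prod_(i < N) p i.
have h3 : 0 < 2 * 3 ^+ n :> R by rewrite mulr_gt0// exprn_gt0.
(* Half of [delta], divided by the bound [3^n] on [P] that multiplies the error of the Laurent
   polynomial. *)
have e0 : 0 < delta / (2 * 3 ^+ n) by rewrite divr_gt0.
have hE : trig_poly _ _ :=
  trig_poly_prod _ E h (fun j => let: And3 _ t _ := hh j in t).
have [Lp degL hL] := trig_poly_laurent _ _ _ e0 hE.
exists P, Lp; split.
- apply: le_trans (scale N _ (leq_addr _ _)).
  apply: le_trans (sum_sqrt_le _ D df c L L0 (ltW c0) _ _); last 2 first.
  + by move=> i; case: (hf' i).
  + by move=> i; case: (hp i).
  have : (size P <= (\sum_(i < N) D i).+1)%N.
    by apply: size_prod_le => i; case: (hp i).
  by rewrite ler_nat /poly_degree; case: (size P).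
- rewrite degL; apply: le_trans (scale M _ (leq_addl _ _)).
  apply: sum_sqrt_le (L0) (ltW c0) _ _ => j; first by case: (hg' j).
  by case: (hh j).
move=> x y x1.
have dK1 : delta ^+ K <= 1 by rewrite exprn_ile1 ?(ltW d0)//; lra.
(* Exact factors are bounded by 2 and errors by 1, so 3 bounds the approximants too. *)
have near3 (a b : R) : `|a| <= 2 -> `|a - b| <= delta ^+ K -> `|b| <= 3.
  move=> a2 ab; rewrite -[b](subKr a); apply: le_trans (ler_normB _ _) _; lra.
have p3 i : `|(p i).[x]| <= 3.
  by have [_ f2 _] := hf' i; have [_ _ fp] := hp i; apply: near3 (f2 x x1) (fp x x1).
have g3 j : `|h j y| <= 3.
  by have [_ g2 _] := hg' j; have [_ _ gh] := hh j; apply: near3 (g2 y) (gh y).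
(* The factors in [x] and in [y] form one product over a sum type, so that [prod_dist] treats all
   [n] at once. *)
pose a (s : 'I_N + 'I_M) := match s with inl i => f i x | inr j => g j y end.
pose b (s : 'I_N + 'I_M) := match s with inl i => (p i).[x] | inr j => h j y end.
have ab : `|\prod_s a s - \prod_s b s| <= delta / 2.
  apply: le_trans (error_budget n delta hd).
  have sn : size (index_enum ('I_N + 'I_M)%type) = n.
    by rewrite [index_enum _]unlock -enumT -cardT card_sum !card_ord.
  rewrite -/K -[X in X%:R * _ * _]sn -[X in _ * 3 ^+ X]sn.
  apply: prod_dist => [|[i|j]|[i|j]|[i|j]] //=; rewrite ?ler1n//.
  + have [_ f2 _] := hf' i; apply: le_trans (f2 x x1) _; lra.
  + have [_ g2 _] := hg' j; apply: le_trans (g2 y) _; lra.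
  + by have [_ _] := hp i; apply.
  + by have [_ _] := hh j; apply.
have Pb : `|P.[x]| <= 3 ^+ n.
  rewrite horner_prod normr_prod.
  apply: le_trans (_ : \prod_(i < N) 3 <= _).
    by apply: ler_prod => i _; rewrite normr_ge0 p3.
  by rewrite prodr_const card_ord ler_weXn2l ?ler1n ?leq_addr.
rewrite !big_sumType /= -horner_prod -/P in ab.
set Q := \prod_(j < M) h j y in ab.
apply: le_trans (ler_distD (P.[x] * Q)%:C _ _) _.
rewrite [in leRHS](splitr delta) rmorphD /=; apply: lerD.
  by rewrite -rmorphB normc_def /= expr0n addr0 sqrtr_sqr lecR.
rewrite [(_ * Q)%:C]rmorphM -mulrBr normrM /=.
have -> : (delta / 2)%:C = (3 ^+ n)%:C * (delta / (2 * 3 ^+ n))%:C.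
  rewrite -rmorphM; congr (_%:C); field.
  by rewrite expf_neq0 ?pnatr_eq0.
apply: ler_pM => //; last exact: hL.
by rewrite normc_def /= expr0n addr0 sqrtr_sqr lecR.
Qed.
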